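(* Let $p$ be a prime and let $q>1$ be a power of $p$. Then Dedekind sums approximate each $a\in\frac{1}{q}\mathbb{Z}_p^{\times}$ (in $\mathbb{Q}_p$).
   Context: $\mathbb{N}$ denotes the positive integers. For a natural number $n\ge 1$ and an integer $m$ with $\gcd(m,n)=1$, the classical Dedekind sum is $s(m,n)=\sum_{k=1}^n ((k/n))((mk/n))$, where $((t))=t-\lfloor t\rfloor-1/2$ if $t\in\mathbb{R}\setminus\mathbb{Z}$ and $((t))=0$ if $t\in\mathbb{Z}$. Put $S(m,n)=12\,s(m,n)$; this is a rational number and $S(m+n,n)=S(m,n)$. For a prime $p$, $\mathbb{Q}_p$ is the field of $p$-adic numbers, $\mathbb{Z}_p$ the ring of $p$-adic integers, $\mathbb{Z}_p^{\times}$ its unit group, and $\frac1q\mathbb{Z}_p^{\times}=\{u/q: u\in\mathbb{Z}_p^{\times}\}$. For $a\in\mathbb{Q}_p$ and a subset $M\subseteq\mathbb{Q}_p$, we say that $M$ approximates $a$ (in $\mathbb{Q}_p$) if for every integer $k\ge 1$ there are $x\in M$ and $b\in\mathbb{Z}_p$ with $a=x+p^k b$. ''Dedekind sums approximate $a$ (in $\mathbb{Q}_p$)'' means that the set $M=\{S(m,n): n\in\mathbb{N},\ 0\le m<n,\ \gcd(m,n)=1\}$ approximates $a$ in $\mathbb{Q}_p$. *)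

(* Defs.v *)
(* Uses MathComp together with the classical layer of MathComp-Analysis. *)
From HB Require Import structures.
From mathcomp Require Import all_boot all_order all_algebra.
From mathcomp Require Import boolp classical_sets.

Set Implicit Arguments.
Unset Strict Implicit.
Unset Printing Implicit Defensive.

Import Order.TTheory GRing.Theory Num.Theory.

Local Open Scope ring_scope.

(* Z_p is the inverse limit of the rings Z/p^k. An element is its sequence of
   residues x_k mod p^k, each represented by an integer in [0, p^k): the single
   equation x_k = x_{k+1} %% p^k says both that the sequence is compatible and
   that every x_k is reduced. *)
Record padic_int (p : nat) (p_pr : prime p) := PadicInt {
  padic_res :> nat -> int;
  padic_resP : forall k, padic_res k = (padic_res k.+1 %% (p ^ k)%N)%Z }.

Section PadicInt.

Variables (p : nat) (p_pr : prime p).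
Local Notation Zp := (padic_int p_pr).
Implicit Types x y z : Zp.

HB.instance Definition _ := gen_eqMixin Zp.
HB.instance Definition _ := gen_choiceMixin Zp.

Lemma padic_intP x y : (forall k, x k = y k) -> x = y.
Proof.
case: x y => f fP [g gP] /= /funext fg; case: g / fg gP => gP.
by rewrite (Prop_irrelevance fP gP).
Qed.

Lemma padic_res_mod x k : (x k %% (p ^ k)%N)%Z = x k.
Proof. by rewrite [x k]padic_resP modz_mod. Qed.

Lemma modz_expS (a : int) k :
  ((a %% (p ^ k.+1)%N)%Z %% (p ^ k)%N)%Z = (a %% (p ^ k)%N)%Z.
Proof.
rewrite [in RHS](divz_eq a (p ^ k.+1)%N) expnS PoszM mulrA modzMDl.
by [].
Qed.

Lemma padic_of_proof (f : nat -> int) :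
    (forall k, (f k = f k.+1 %[mod (p ^ k)%N])%Z) ->
  forall k, (f k %% (p ^ k)%N)%Z =
            ((f k.+1 %% (p ^ k.+1)%N)%Z %% (p ^ k)%N)%Z.
Proof. by move=> fP k; rewrite modz_expS. Qed.

Definition padic_of f fP : Zp := PadicInt p_pr (@padic_of_proof f fP).

Lemma padic_resS x k : (x k = x k.+1 %[mod (p ^ k)%N])%Z.
Proof. by rewrite [x k]padic_resP modz_mod. Qed.

Lemma padic_cst_proof (a : int) k : (a = a %[mod (p ^ k)%N])%Z.
Proof. by []. Qed.

Lemma padic_opp_proof x k : (- x k = - x k.+1 %[mod (p ^ k)%N])%Z.
Proof. by rewrite -modzNm padic_resS modzNm. Qed.

Lemma padic_add_proof x y k :
  (x k + y k = x k.+1 + y k.+1 %[mod (p ^ k)%N])%Z.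
Proof. by rewrite -modzDm padic_resS (padic_resS y) modzDm. Qed.

Lemma padic_mul_proof x y k :
  (x k * y k = x k.+1 * y k.+1 %[mod (p ^ k)%N])%Z.
Proof. by rewrite -modzMm padic_resS (padic_resS y) modzMm. Qed.

Definition padic_zero := padic_of (padic_cst_proof 0).
Definition padic_one := padic_of (padic_cst_proof 1).
Definition padic_opp x := padic_of (padic_opp_proof x).
Definition padic_add x y := padic_of (padic_add_proof x y).
Definition padic_mul x y := padic_of (padic_mul_proof x y).

Fact padic_addA : associative padic_add.
Proof. by move=> x y z; apply: padic_intP => k /=; rewrite modzDml modzDmr addrA. Qed.

Fact padic_addC : commutative padic_add.
Proof. by move=> x y; apply: padic_intP => k /=; rewrite addrC. Qed.

Fact padic_add0 : left_id padic_zero padic_add.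
Proof. by move=> x; apply: padic_intP => k /=; rewrite modzDml add0r padic_res_mod. Qed.

Fact padic_addN : left_inverse padic_zero padic_opp padic_add.
Proof. by move=> x; apply: padic_intP => k /=; rewrite modzDml addNr. Qed.

HB.instance Definition _ :=
  GRing.isZmodule.Build Zp padic_addA padic_addC padic_add0 padic_addN.

Fact padic_mulA : associative padic_mul.
Proof. by move=> x y z; apply: padic_intP => k /=; rewrite modzMml modzMmr mulrA. Qed.

Fact padic_mulC : commutative padic_mul.
Proof. by move=> x y; apply: padic_intP => k /=; rewrite mulrC. Qed.

Fact padic_mul1 : left_id padic_one padic_mul.
Proof. by move=> x; apply: padic_intP => k /=; rewrite modzMml mul1r padic_res_mod. Qed.

Fact padic_mulD : left_distributive padic_mul padic_add.
Proof.
by move=> x y z; apply: padic_intP => k /=; rewrite modzMml modzDm mulrDl.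
Qed.

Fact padic_1neq0 : padic_one != 0.
Proof.
apply/eqP => /(congr1 (fun x : Zp => x 1)) /=.
by rewrite expn1 mod0z modz_small // ltz_nat prime_gt1.
Qed.

HB.instance Definition _ := GRing.Zmodule_isComNzRing.Build Zp
  padic_mulA padic_mulC padic_mul1 padic_mulD padic_1neq0.

Definition padic_unit : {pred Zp} := fun x => `[< exists y, y * x = 1 >].
Definition padic_inv x : Zp := xget x [set y | y * x = 1].

Fact padic_mulV : {in padic_unit, left_inverse 1 padic_inv *%R}.
Proof.
by move=> x /asboolP[y yx]; exact: (@xgetPex _ x [set y | y * x = 1] (ex_intro _ y yx)).
Qed.

Fact padic_unitP x y : y * x = 1 -> padic_unit x.
Proof. by move=> yx; apply/asboolP; exists y. Qed.

Fact padic_inv_out : {in [predC padic_unit], padic_inv =1 id}.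
Proof.
move=> x /negP xNu; rewrite /padic_inv; case: xgetP => // y _ /= yx.
by case: xNu; exact: padic_unitP yx.
Qed.

HB.instance Definition _ := GRing.ComNzRing_hasMulInverse.Build Zp
  padic_mulV padic_unitP padic_inv_out.

Lemma padic_res_le x k l : (k <= l)%N -> x k = (x l %% (p ^ k)%N)%Z.
Proof.
elim: l => [|l IHl]; first by rewrite leqn0 => /eqP ->; rewrite padic_res_mod.
rewrite leq_eqVlt => /predU1P[->|/[!ltnS] kl]; first by rewrite padic_res_mod.
rewrite (IHl kl) [x l]padic_resP -(subnK kl) expnD PoszM.
rewrite [in RHS](divz_eq (x _) ((p ^ (l - k))%N%:Z * (p ^ k)%N)) mulrA.
by rewrite modzMDl.
Qed.

Lemma padic_neq0 x : x != 0 -> exists k, ~~ (p ^ k %| `|x k|)%N.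
Proof.
move=> x0; apply: contrapT => xk; case/eqP: x0.
apply: padic_intP => k /=; rewrite mod0z -padic_res_mod.
apply/dvdz_mod0P; rewrite dvdzE /=.
by case: (boolP (p ^ k %| `|x k|)%N) => // nd; case: xk; exists k.
Qed.

Lemma padic_res_dvd x k l : (k <= l)%N ->
  (p ^ k %| `|x k|)%N = (p ^ k %| `|x l|)%N.
Proof.
move=> kl; rewrite -[LHS](dvdzE (p ^ k)%N) -[RHS](dvdzE (p ^ k)%N).
by rewrite (padic_res_le x kl); apply/dvdz_mod0P/dvdz_mod0P; rewrite modz_mod.
Qed.

Fact padic_int_idomain : GRing.integral_domain_axiom Zp.
Proof.
move=> x y xy0; apply/negPn; rewrite negb_or; apply/negP => /andP[x0 y0].
have [[k xk] [l yl]] := (padic_neq0 x0, padic_neq0 y0).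
have := congr1 (fun z : Zp => z (k + l)%N) xy0 => /= /[!mod0z] /dvdz_mod0P.
rewrite dvdzE abszM /= => dvd.
rewrite (padic_res_dvd x (leq_addr l k)) in xk.
rewrite (padic_res_dvd y (leq_addl k l)) in yl.
have x_gt0 : (0 < `|x (k + l)%N|)%N.
  by rewrite lt0n; apply: contraNneq xk => ->; rewrite dvdn0.
have y_gt0 : (0 < `|y (k + l)%N|)%N.
  by rewrite lt0n; apply: contraNneq yl => ->; rewrite dvdn0.
move: xk yl dvd; rewrite !pfactor_dvdn ?muln_gt0 ?x_gt0 //.
rewrite lognM // -!ltnNge => xk yl.
by rewrite leqNgt -addnS leq_add // ltnW.
Qed.

HB.instance Definition _ :=
  GRing.ComUnitRing_isIntegral.Build Zp padic_int_idomain.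

Lemma padic_natr n k : (n%:R : Zp) k = (n%:Z %% (p ^ k)%N)%Z.
Proof.
by elim: n => [//|n IHn]; rewrite -addn1 natrD /= IHn modzDm PoszD.
Qed.

Lemma padic_int_natr_eq0 n : ((n%:R : Zp) == 0) = (n == 0)%N.
Proof.
apply/eqP/eqP => [n0|->//]; have := congr1 (fun z : Zp => z n) n0.
rewrite padic_natr /= mod0z modz_small; first by case.
by rewrite ltz_nat ltn_expl // prime_gt1.
Qed.

(* Q_p is the fraction field of Z_p, and tofrac the inclusion of Z_p in Q_p. *)
Local Notation Qp := {fraction Zp}.
Local Notation "x %:F" := (@FracField.tofrac Zp x) : ring_scope.

(* In characteristic zero, ratr is the inclusion of the field of rationals. *)
Lemma padic_pchar : [pchar Qp] =i pred0.
Proof.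
move=> l; rewrite !inE; apply/negP => /andP[/prime_gt0].
by rewrite -(rmorph_nat (@FracField.tofrac Zp)) tofrac_eq0 padic_int_natr_eq0 lt0n => /negP.
Qed.

Definition padic_unit_over (q : nat) : set Qp :=
  [set a | exists2 u : Zp, u \is a GRing.unit & a = u%:F / q%:R].

Definition approximates (M : set Qp) (a : Qp) : Prop :=
  forall k : nat, (1 <= k)%N ->
  exists x : Qp, exists b : Zp, M x /\ a = x + p%:R ^+ k * b%:F.

End PadicInt.

Arguments padic_unit_over {p} p_pr q.

Notation "''Qp_' p_pr" := {fraction padic_int p_pr}
  (at level 8, p_pr at level 2, format "''Qp_' p_pr") : type_scope.

(* The function ((t)); rational t suffice for Dedekind sums. *)
Definition sawtooth (t : rat) : rat :=
  if t \is a Num.int then 0 else t - (Num.floor t)%:~R - 1 / 2.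

Definition dedekind_sum (m : int) (n : nat) : rat :=
  \sum_(1 <= k < n.+1)
    sawtooth (k%:R / n%:R) * sawtooth (m%:~R * k%:R / n%:R).

(* The normalised sum S(m, n) = 12 s(m, n). *)
Definition dedekind_S (m : int) (n : nat) : rat := 12 * dedekind_sum m n.

Definition dedekind_values (p : nat) (p_pr : prime p) : set 'Qp_p_pr :=
  [set x | exists m n : nat,
     [/\ (0 < n)%N, (0 <= m < n)%N, coprime m n
       & x = ratr (dedekind_S m%:Z n)]].

Arguments dedekind_values {p} p_pr.

Definition dedekind_sums_approximate
    (p : nat) (p_pr : prime p) (a : 'Qp_p_pr) : Prop :=
  approximates (dedekind_values p_pr) a.

(* Main.v *)
Require Import Defs.
From mathcomp Require Import all_boot all_order all_algebra.
From mathcomp Require Import boolp classical_sets.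
From mathcomp Require Import ring zify.

Set Implicit Arguments.
Unset Strict Implicit.
Unset Printing Implicit Defensive.

(** The sums with m = 1 already suffice.  Summing squares gives
    S(1, n) = (n - 1)(n - 2) / n = n - 3 + 2 / n ([dedekind_S1]).  For
    n = 2qh this is (2q^2h - 3q + 1/h) / q, so S(1, n) is close to u / q
    exactly when 2q^2h - 3q + 1/h is close to u, that is, when h nearly
    solves
      h (u + 3q) - 2q^2 h^2 = 1
    in Z_p.  The factor 2 in n = 2qh cancels the numerator of 2 / n, which
    lets p = 2 go through with the odd primes.  Since p divides q, modulo p
    the equation is linear with the unit coefficient u, and Hensel lifting
    ([hensel_quadratic]) solves it modulo every p^N by an integer h prime to
    p, which can be taken positive ([padic_unit_mod_quadratic]).

    The denominator n contributes a factor q, so agreement of S(1, n) with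
    u / q modulo p^k requires solving the equation modulo p^N = p^k q. *)

Import Order.TTheory GRing.Theory Num.Theory.
Local Open Scope ring_scope.

(** * The Dedekind sums S(1, n) *)

Lemma sawtooth_frac (k n : nat) : (0 < k < n)%N ->
  sawtooth (k%:R / n%:R) = k%:R / n%:R - 1 / 2.
Proof.
move=> /andP[k_gt0 lt_kn]; have n_gt0 : (0 : rat) < n%:R by rewrite ltr0n; lia.
have t_gt0 : (0 : rat) < k%:R / n%:R by rewrite divr_gt0 // ltr0n.
have t_lt1 : (k%:R / n%:R : rat) < 1 by rewrite ltr_pdivrMr // mul1r ltr_nat.
have fl0 : Num.floor (k%:R / n%:R : rat) = 0.
  by apply: floor_def; rewrite ltW //= add0r.
by rewrite /sawtooth intrEfloor fl0 lt_eqF // subr0.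
Qed.

(** The Dedekind sum has c = 1 / (n + 1), but induction on the number n of
    terms needs a step c independent of n. *)
Lemma sum_centered_squares (c : rat) (n : nat) :
  12 * \sum_(1 <= k < n.+1) (k%:R * c - 1 / 2) ^+ 2 =
  2 * n%:R * (n%:R + 1) * (2 * n%:R + 1) * c ^+ 2
    - 6 * n%:R * (n%:R + 1) * c + 3 * n%:R.
Proof.
elim: n => [|n IHn]; first by rewrite big_geq //; ring.
by rewrite big_nat_recr //= mulrDr IHn -natr1; field.
Qed.

Lemma dedekind_S1 (n : nat) : (0 < n)%N ->
  dedekind_S 1 n = (n%:R - 1) * (n%:R - 2) / n%:R.
Proof.
case: n => // n _; rewrite /dedekind_S /dedekind_sum big_nat_recr //=.
have n0 : (n.+1%:R : rat) != 0 by rewrite pnatr_eq0.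
have -> : sawtooth (n.+1%:R / n.+1%:R) = 0 by rewrite divff // /sawtooth rpred1.
rewrite mul0r addr0.
under eq_big_nat => k /andP[k1 kn].
  rewrite mul1r sawtooth_frac ?k1 // -expr2; over.
rewrite sum_centered_squares; move: n0; rewrite -natr1 => n0.
by field.
Qed.

(** * Solving the quadratic congruence *)

(** Modulo p the equation h A - c h^2 = 1 is the linear equation h A = 1,
    solved by w.  As the derivative A - 2 c h is A modulo p, the correction
    of an approximate root h with error E can always use the same inverse w:
    replacing h by h - w E multiplies the error by
    1 - w A + c (2 h w - w^2 E), a multiple of p. *)
Lemma hensel_quadratic (p A c w : int) : (p %| c)%Z -> (p %| w * A - 1)%Z ->
  forall N, exists h : int, (p ^+ N %| h * A - c * h ^+ 2 - 1)%Z.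
Proof.
move=> /dvdzP[c' c_eq] /dvdzP[r wA].
elim=> [|N [h /dvdzP[s hN]]]; first by exists 0; rewrite expr0 dvd1z.
set E := h * A - c * h ^+ 2 - 1 in hN.
exists (h - w * E); apply/dvdzP.
exists (s * (- r + c' * (2 * h * w - w ^+ 2 * E))).
transitivity (E * (- (w * A - 1) + c * (2 * h * w - w ^+ 2 * E))).
  by rewrite /E; ring.
by rewrite wA c_eq {1}hN (exprS p); ring.
Qed.

(** Dividing the quadratic relation by qh turns it into the approximation of
    u / q by S(1, 2qh); the factor q of the error term P q h b is lost. *)
Lemma divide_quadratic (F : fieldType) (u q h P b : F) :
    2 != 0 :> F -> q != 0 -> h != 0 ->
    h * u = (2 * q * h - 1) * (q * h - 1) + P * q * (h * b) ->
  u / q = (2 * q * h - 1) * (2 * q * h - 2) / (2 * q * h) + P * b.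
Proof.
move=> two0 q0 h0 /(canRL (mulKf h0)) ->.
by field; rewrite q0 h0 two0.
Qed.

(** * Integers inside Z_p and Q_p *)

Section PadicIntegers.

Variables (p : nat) (p_pr : prime p).
Local Notation Zp := (padic_int p_pr).

Lemma padic_intr (a : int) k : (a%:~R : Zp) k = (a %% (p ^ k)%N)%Z.
Proof.
case: a => n; first by rewrite -padic_natr.
rewrite NegzE mulrNz -[n.+1%:~R]/(n.+1%:R) /= padic_natr.
by rewrite modzNm.
Qed.

(** The cofactor b is read off the residues of x: its residue modulo p^k is
    (x_{k+N} - x_N) / p^N, since dividing by p^N loses N digits. *)
Lemma padic_residue_expansion (x : Zp) N :
  exists b : Zp, x = (x N)%:~R + p%:R ^+ N * b.
Proof.
have pN0 : (p ^ N)%N%:Z != 0 by rewrite eqz_nat -lt0n expn_gt0 prime_gt0.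
pose f k := ((x (k + N)%N - x N) %/ (p ^ N)%N)%Z.
have fE k : f k * (p ^ N)%N = x (k + N)%N - x N.
  apply: divzK; rewrite -eqz_mod_dvd.
  by rewrite [x N](padic_res_le x (leq_addl k N)) modz_mod.
have fP k : (f k = f k.+1 %[mod (p ^ k)%N])%Z.
  apply/eqP; rewrite eqz_mod_dvd -(@dvdz_mul2r (p ^ N)%N) //.
  rewrite mulrBl !fE -PoszM -expnD.
  rewrite opprB addrA subrK -eqz_mod_dvd addSn.
  by rewrite -padic_resS.
exists (padic_of p_pr fP); apply: padic_intP => k.
rewrite -natrX /= padic_intr padic_natr modzMm modzDm.
by rewrite mulrC fE addrC subrK -padic_res_le // leq_addr.
Qed.

(** The inverses of h modulo the powers p^k, given by Bezout, are unique
    modulo p^k, hence compatible: they form a p-adic integer. *)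
Lemma padic_natr_unit (h : nat) : coprime h p -> (h%:R : Zp) \is a GRing.unit.
Proof.
move=> hp.
have cop k : coprimez (p ^ k)%N h by rewrite coprimezE /= coprimeXl // coprime_sym.
have inv k : exists g : int, ((p ^ k)%N %| g * h%:Z - 1)%Z.
  have /coprimezP[[u v] /= uv] := cop k.
  by exists v; apply/dvdzP; exists (- u); rewrite -uv; ring.
have [f fP] := choice inv.
have f_compat k : (f k = f k.+1 %[mod (p ^ k)%N])%Z.
  apply/eqP; rewrite eqz_mod_dvd -(Gauss_dvdzl _ (cop k)).
  have -> : (f k - f k.+1) * h = (f k * h - 1) - (f k.+1 * h - 1) by ring.
  rewrite rpredB //; apply: dvdz_trans (fP k.+1).
  by rewrite expnS PoszM dvdz_mull.
have: padic_of p_pr f_compat * h%:R = 1 :> Zp.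
  apply: padic_intP => k; rewrite /= padic_natr modzMm.
  by apply/eqP; rewrite eqz_mod_dvd.
exact: padic_unitP.
Qed.

(** The right-hand side is h q S(1, 2qh) up to the error term, and that error
    is a multiple of h so that it remains p-integral after division by h:
    this is where h being prime to p matters. *)
Lemma padic_unit_mod_quadratic (q : nat) (u : Zp) N : (p %| q)%N -> (0 < N)%N ->
    u \is a GRing.unit ->
  exists2 h : nat, (0 < h)%N & exists b : Zp,
    h%:R * u = (2 * q%:R * h%:R - 1) * (q%:R * h%:R - 1) + p%:R ^+ N * (h%:R * b).
Proof.
move=> pq N_gt0 u_unit.
have [y yu] : exists y : Zp, y * u = 1 by exists u^-1; rewrite mulVr.
have p_pN : (p%:Z %| (p ^ N)%N%:Z)%Z by rewrite dvdzE /= dvdn_exp.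
pose A := u N + 3 * q%:Z; pose c := 2 * q%:Z ^+ 2.
have pc : (p%:Z %| c)%Z by rewrite /c expr2 !dvdz_mull.
have wA : (p%:Z %| y N * A - 1)%Z.
  have yuN : ((p ^ N)%N%:Z %| y N * u N - 1)%Z.
    rewrite -eqz_mod_dvd; apply/eqP.
    exact: (congr1 (fun z : Zp => z N) yu).
  have -> : y N * A - 1 = (y N * u N - 1) + 3 * y N * q by rewrite /A; ring.
  by rewrite rpredD ?(dvdz_trans p_pN yuN) // dvdz_mull.
have [h0 h0P] := hensel_quadratic pc wA N.
have pN0 : (p ^ N)%N%:Z != 0 by rewrite eqz_nat -lt0n expn_gt0 prime_gt0.
have [h hP] : exists h : nat, ((p ^ N)%N%:Z %| h%:Z * A - c * h%:Z ^+ 2 - 1)%Z.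
  (* Moving a root by a multiple of p^N keeps it a root modulo p^N. *)
  exists `|(h0 %% (p ^ N)%N)%Z|%N; rewrite gez0_abs ?modz_ge0 //.
  set h1 := (h0 %% _)%Z; have h01 := divz_eq h0 (p ^ N)%N; rewrite -/h1 in h01.
  have -> : h1 * A - c * h1 ^+ 2 - 1 = (h0 * A - c * h0 ^+ 2 - 1)
     - (h0 %/ (p ^ N)%N)%Z * (A - c * (h0 + h1)) * (p ^ N)%N.
    by rewrite {1 2 4}h01; ring.
  by rewrite rpredB ?dvdz_mull // -natz natrX natz.
(* A common factor p of h and p^N would divide the constant term 1. *)
have hp : coprime h p.
  rewrite coprime_sym prime_coprime //; apply/negP => ph.
  have : (p%:Z %| 1)%Z.
    have -> : 1 = h%:Z * (A - c * h%:Z) - (h%:Z * A - c * h%:Z ^+ 2 - 1) :> int.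
      by ring.
    by rewrite rpredB ?(dvdz_trans p_pN hP) // dvdz_mulr.
  by rewrite dvdzE /= dvdn1 => /eqP p1; move: p_pr; rewrite p1.
exists h.
  by case: h hp {hP} => //; rewrite /coprime gcd0n => /eqP p1; move: p_pr; rewrite p1.
have [t ht] := dvdzP hP; have [v uv] := padic_residue_expansion u N.
exists (h%:R^-1 * (t%:~R + h%:R * v)).
rewrite mulVKr ?padic_natr_unit // [p%:R ^+ N * _]mulrDr.
have -> : p%:R ^+ N * t%:~R = h%:R * (u N)%:~R + 3 * q%:R * h%:R
    - 2 * q%:R ^+ 2 * h%:R ^+ 2 - 1 :> Zp.
  have /(congr1 (fun z : int => z%:~R : Zp)) := esym ht.
  rewrite /A /c !(rmorphB, rmorphD, rmorphM, rmorphXn, rmorph1) /=.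
  by rewrite -!pmulrn mulrC => ->; ring.
by rewrite {1}uv; ring.
Qed.

Lemma padic_frac_natr_eq0 m : ((m%:R : 'Qp_p_pr) == 0) = (m == 0)%N.
Proof.
by rewrite -(rmorph_nat (@FracField.tofrac Zp)) tofrac_eq0 padic_int_natr_eq0.
Qed.

(** [ratr] takes the fraction in lowest terms.  Cross multiplication shows that
    any other fraction has the same image, as no positive integer vanishes in
    characteristic zero. *)
Lemma ratr_div_natr (x : rat) (a : int) (n : nat) : (0 < n)%N ->
  x = a%:~R / n%:R -> ratr x = a%:~R / n%:R :> 'Qp_p_pr.
Proof.
move=> n_gt0 x_eq.
have n0 : (n%:R : 'Qp_p_pr) != 0 by rewrite padic_frac_natr_eq0 -lt0n.
have d0 : ((denq x)%:~R : 'Qp_p_pr) != 0.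
  by rewrite -absz_denq padic_frac_natr_eq0 absz_eq0 denq_neq0.
have cross : numq x * n%:Z = a * denq x.
  apply: (@intr_inj rat); rewrite !rmorphM /= numqE mulrAC; congr (_ * _).
  by rewrite {1}x_eq divfK // pnatr_eq0 -lt0n.
apply/eqP; rewrite /ratr eqr_div //.
by have := congr1 (fun z : int => (z%:~R : 'Qp_p_pr)) cross; rewrite !rmorphM /= => ->.
Qed.

End PadicIntegers.

Local Close Scope ring_scope.

Theorem theorem4 (p : nat) (p_pr : prime p) (q : nat) (q_gt1 : 1 < q)
    (q_pow : exists e : nat, q = p ^ e) (a : 'Qp_p_pr)
    (a_in : padic_unit_over p_pr q a) :
  dedekind_sums_approximate a.
Proof.
have [e q_eq] := q_pow; have [u u_unit ->] := a_in => k k_gt0.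
have pq : p %| q.
  by case: e q_eq q_gt1 => [|e] ->; rewrite ?expnS ?dvdn_mulr.
(* The extra exponent e absorbs the denominator q = p ^ e of the target. *)
have N_gt0 : 0 < k + e by rewrite addn_gt0 k_gt0.
have [h h_gt0 [b hub]] := padic_unit_mod_quadratic pq N_gt0 u_unit.
pose n := 2 * q * h; have n_gt1 : 1 < n by rewrite /n; nia.
exists (ratr (dedekind_S 1 n)), b; split.
  by exists 1, n; split; rewrite ?coprime1n // ltnW.
have n_gt0 := ltnW n_gt1.
have -> : (ratr (dedekind_S 1 n) =
    (n%:R - 1) * (n%:R - 2) / n%:R :> 'Qp_p_pr)%R.
  rewrite (@ratr_div_natr _ p_pr _ ((n%:Z - 1) * (n%:Z - 2)) n) //.
    by rewrite intrM !intrB.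
  by rewrite dedekind_S1 // intrM !intrB.
have [] : [/\ (2%:R : 'Qp_p_pr) != 0, (q%:R : 'Qp_p_pr) != 0
             & (h%:R : 'Qp_p_pr) != 0]%R.
  by rewrite !padic_frac_natr_eq0; split => //; lia.
move=> two0 q0 h0.
have hubF := congr1 (@FracField.tofrac (padic_int p_pr)) hub.
rewrite exprD -[(p%:R ^+ e)%R]natrX -q_eq in hubF.
rewrite !(rmorph_nat, rmorph1, rmorphB, rmorphD, rmorphM, rmorphXn) /= in hubF.
by rewrite /n !natrM; apply: divide_quadratic.
Qed.
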